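(* Let $m_r=1/\mu_r$ for $r=0,1,2$ and assume $m_1h_1\ge m_2h_2$. In the two-stage clearing system described in the context, the following hold. 1. If $m_1<m_2$, there exists $i'$ sufficiently large such that an optimal policy works at Station 1 in every state $(i,j,k,\ell)\in\mathbb{X}_{\widehat D}$ with $i\ge i'$. 2. If $m_1>m_2$: (a) there exists an optimal policy that works at Station 2 in all states $(i,1,1,0)$ and $(i,2,0,0)$, for all $i\ge 0$; (b) in states of the form $(i,1,0,1)$: (i) if $m_2<m_1\le 2m_2$, there exists $i'$ sufficiently large such that an optimal decision at $(i,1,0,1)$ is to work at Station 1 for all $i\ge i'$; (ii) if $m_1>2m_2$, there exists $\mu_0'>0$ such that for any fixed $\mu_0$ with $0<\mu_0<\mu_0'$ (the parameters $\mu_1,\mu_2,h_0,h_1,h_2$ being held fixed), there is an $i'$ sufficiently large such that an optimal policy works at Station 2 in $(i,1,0,1)$ for all $i\ge i'$.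
   Context: Model. A clearing system (no external arrivals, a finite number of initial jobs) has two servers. Each job first receives Phase I service at Station 0 from one server (both servers may work in parallel there). When a Station 0 service completes, the same server, together with the job, must perform Phase II either at Station 1 (action $a=1$; parallel, service begins immediately) or at Station 2 (action $a=2$; a single-service facility handling one job at a time, so the job-server pair may have to queue). A server can start a new Station 0 job only after its current job has completed both phases, and it does so immediately if a job is waiting. Services are non-preemptive, independent and exponential with rates $\mu_0,\mu_1,\mu_2>0$ at Stations 0, 1, 2; $m_r=1/\mu_r$ are the mean service times. Holding costs $h_0,h_1,h_2>0$ per job per unit time are incurred by jobs (waiting or in service) at Stations 0, 1, 2. The objective is to minimize the expected total holding cost until the system is empty. States are $(i,j,k,\ell)$: $i$ jobs in the Station 0 queue (not in service), $j$ in service at Station 0, $k$ in service at Station 1, $\ell$ at Station 2 (waiting or in service). The state space is $\mathbb{X}=\{(i,j,k,\ell)\in\mathbb{Z}_+^4 : (i=0,\ j+k+\ell=1)\text{ or }(i\ge 0,\ j+k+\ell=2)\}$, together with the empty state $(0,0,0,0)$. The decision states (an action is chosen for the job completing Station 0 service) are $\mathbb{X}_D=\{(0,1,0,0)\}\cup\{(i,2,0,0),(i,1,0,1),(i,1,1,0): i\ge 0\}$, and $\mathbb{X}_{\widehat D}=\mathbb{X}_D\setminus\{(0,1,0,0)\}$. Value function. Let $v(i,j,k,\ell)$ be the minimal expected total cost from state $(i,j,k,\ell)$, with $v(0,0,0,0)=0$. With $d=d(j,k,\ell)=j\mu_0+k\mu_1+\min\{\ell,1\}\mu_2$, it satisfies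 (terms with zero coefficient are read as zero): for $i=0$, $$v(0,j,k,\ell)=\tfrac{1}{d}\big[jh_0+kh_1+\ell h_2+k\mu_1 v(0,j,k-1,\ell)+\min\{\ell,1\}\mu_2 v(0,j,k,\ell-1)+j\mu_0\min\{v(0,j-1,k+1,\ell),v(0,j-1,k,\ell+1)\}\big],$$ and for $i\ge 1$, $$v(i,j,k,\ell)=\tfrac{1}{d}\big[(i+j)h_0+kh_1+\ell h_2+k\mu_1 v(i-1,j+1,k-1,\ell)+\min\{\ell,1\}\mu_2 v(i-1,j+1,k,\ell-1)+j\mu_0\min\{v(i,j-1,k+1,\ell),v(i,j-1,k,\ell+1)\}\big].$$ These equations determine $v$ recursively. A policy assigns an action in $\{1,2\}$ to each decision state; it is optimal if it attains the minimum in these equations at every decision state. Thus working at Station 1 (resp. Station 2) is an optimal decision at $(i,j,k,\ell)\in\mathbb{X}_D$ iff $v(i,j-1,k+1,\ell)-v(i,j-1,k,\ell+1)\le 0$ (resp. $\ge 0$). *)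

(* Defs.v *)
From Stdlib Require Import Reals Lra Lia Arith.

Open Scope R_scope.

Inductive action := Station1 | Station2.

(* A state (i, j, k, l) is passed as four curried naturals: i jobs queueing at
   Station 0, j in service there, k in service at Station 1, l waiting or in
   service at Station 2. *)
Definition nonempty_state (i j k l : nat) : Prop :=
  (i = 0 /\ j + k + l = 1)%nat \/ (j + k + l = 2)%nat.

Definition decision_state_hat (i j k l : nat) : Prop :=
  (j = 2 /\ k = 0 /\ l = 0)%nat \/
  (j = 1 /\ k = 0 /\ l = 1)%nat \/
  (j = 1 /\ k = 1 /\ l = 0)%nat.

Definition decision_state (i j k l : nat) : Prop :=
  (i = 0 /\ j = 1 /\ k = 0 /\ l = 0)%nat \/ decision_state_hat i j k l.

(* Value of v once a job has completed Station 0 service in (i, j, k, l) and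
   action a is taken; only relevant for 0 < j. *)
Definition after (v : nat -> nat -> nat -> nat -> R) (i j k l : nat)
    (a : action) : R :=
  match a with
  | Station1 => v i (j - 1)%nat (k + 1)%nat l
  | Station2 => v i (j - 1)%nat k (l + 1)%nat
  end.

Definition min_after (v : nat -> nat -> nat -> nat -> R) (i j k l : nat) : R :=
  Rmin (after v i j k l Station1) (after v i j k l Station2).

Definition total_rate (mu0 mu1 mu2 : R) (j k l : nat) : R :=
  INR j * mu0 + INR k * mu1 + INR (Nat.min l 1) * mu2.

(* Right-hand side of the optimality equation at (i, j, k, l).  A term with
   truncated argument k - 1, l - 1 or j - 1 (from 0) has coefficient 0. *)
Definition bellman (mu0 mu1 mu2 h0 h1 h2 : R)
    (v : nat -> nat -> nat -> nat -> R) (i j k l : nat) : R :=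
  let d := total_rate mu0 mu1 mu2 j k l in
  match i with
  | O =>
      / d * (INR j * h0 + INR k * h1 + INR l * h2
        + INR k * mu1 * v 0%nat j (k - 1)%nat l
        + INR (Nat.min l 1) * mu2 * v 0%nat j k (l - 1)%nat
        + INR j * mu0 * min_after v 0%nat j k l)
  | S i' =>
      / d * (INR (i + j) * h0 + INR k * h1 + INR l * h2
        + INR k * mu1 * v i' (j + 1)%nat (k - 1)%nat l
        + INR (Nat.min l 1) * mu2 * v i' (j + 1)%nat k (l - 1)%nat
        + INR j * mu0 * min_after v i j k l)
  end.

(* The values of v outside the state space are unconstrained. *)
Definition value_function (mu0 mu1 mu2 h0 h1 h2 : R)
    (v : nat -> nat -> nat -> nat -> R) : Prop :=
  v 0%nat 0%nat 0%nat 0%nat = 0 /\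
  forall i j k l : nat, nonempty_state i j k l ->
    v i j k l = bellman mu0 mu1 mu2 h0 h1 h2 v i j k l.

Definition optimal_decision (v : nat -> nat -> nat -> nat -> R)
    (i j k l : nat) (a : action) : Prop :=
  after v i j k l a = min_after v i j k l.

(* The values of a policy outside the decision states are irrelevant. *)
Definition optimal_policy (v : nat -> nat -> nat -> nat -> R)
    (p : nat -> nat -> nat -> nat -> action) : Prop :=
  forall i j k l : nat, decision_state i j k l ->
    optimal_decision v i j k l (p i j k l).

(* Existence and uniqueness of the value function: every transition decreases
   the number of services still to be completed by one. *)

Definition remaining_services (i j k l : nat) : nat := (2 * (i + j) + k + l)%nat.

Fixpoint value_rec (mu0 mu1 mu2 h0 h1 h2 : R) (n : nat)
    : nat -> nat -> nat -> nat -> R :=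
  match n with
  | O => fun _ _ _ _ => 0
  | S n' => bellman mu0 mu1 mu2 h0 h1 h2 (value_rec mu0 mu1 mu2 h0 h1 h2 n')
  end.

Lemma bellman_ext (mu0 mu1 mu2 h0 h1 h2 : R)
    (v w : nat -> nat -> nat -> nat -> R) (i j k l : nat) :
  nonempty_state i j k l ->
  (forall i' j' k' l' : nat,
     nonempty_state i' j' k' l' \/ (i' + j' + k' + l' = 0)%nat ->
     S (remaining_services i' j' k' l') = remaining_services i j k l ->
     v i' j' k' l' = w i' j' k' l') ->
  bellman mu0 mu1 mu2 h0 h1 h2 v i j k l =
  bellman mu0 mu1 mu2 h0 h1 h2 w i j k l.
Proof.
intros Hs H.
assert (Hj : INR j * mu0 * min_after v i j k l = INR j * mu0 * min_after w i j k l).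
{ destruct j as [|j]; [simpl; ring|].
  f_equal; unfold min_after, after.
  f_equal; apply H; unfold nonempty_state, remaining_services in *; lia. }
unfold bellman; destruct i as [|i]; rewrite Hj; do 2 f_equal; f_equal;
  [f_equal| |f_equal|].
1, 3: destruct k as [|k]; [simpl; ring|]; f_equal; apply H;
  unfold nonempty_state, remaining_services in *; lia.
all: destruct l as [|l]; [simpl; ring|]; f_equal; apply H;
  unfold nonempty_state, remaining_services in *; lia.
Qed.

Lemma value_function_exists (mu0 mu1 mu2 h0 h1 h2 : R) :
  exists v, value_function mu0 mu1 mu2 h0 h1 h2 v.
Proof.
exists (fun i j k l =>
  value_rec mu0 mu1 mu2 h0 h1 h2 (remaining_services i j k l) i j k l).
split; [reflexivity|].
intros i j k l Hs.
destruct (remaining_services i j k l) as [|n] eqn:En.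
{ unfold nonempty_state, remaining_services in *; lia. }
simpl value_rec; apply bellman_ext; [exact Hs|].
intros i' j' k' l' _ E.
replace (remaining_services i' j' k' l') with n by lia; reflexivity.
Qed.

Lemma value_function_unique (mu0 mu1 mu2 h0 h1 h2 : R)
    (v w : nat -> nat -> nat -> nat -> R) :
  value_function mu0 mu1 mu2 h0 h1 h2 v ->
  value_function mu0 mu1 mu2 h0 h1 h2 w ->
  forall i j k l : nat, nonempty_state i j k l -> v i j k l = w i j k l.
Proof.
intros [Hv0 Hv] [Hw0 Hw].
enough (H : forall n i j k l, remaining_services i j k l = n ->
  nonempty_state i j k l -> v i j k l = w i j k l).
{ intros i j k l; apply (H _ i j k l eq_refl). }
induction n as [|n IH]; intros i j k l En Hs.
{ unfold nonempty_state, remaining_services in *; lia. }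
rewrite Hv, Hw by exact Hs.
apply bellman_ext; [exact Hs|].
intros i' j' k' l' [Hs'|H0] E.
- apply IH; [lia|exact Hs'].
- replace i' with 0%nat by lia; replace j' with 0%nat by lia;
  replace k' with 0%nat by lia; replace l' with 0%nat by lia.
  now rewrite Hv0, Hw0.
Qed.

(* Main.v *)
(* Let [x_i], [y_i], [z_i] be the cost of Station 1 minus the cost of Station 2
   at the decision states (i,2,0,0), (i,1,1,0) and (i,1,0,1).  The optimality
   equations express [y_(i+1)] and [z_(i+1)] affinely through [x_i], and
   [x_(i+1)] through [x_i], [min (y_(i+1), 0)] and [max (z_(i+1), 0)]: the values
   [v], which grow quadratically in [i], cancel, and a one-dimensional piecewise
   linear recursion with forcing affine in [i] remains.  Its positive part is
   contracting, so the sign of the slope of the forcing decides the sign of the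
   gap for large [i].  When mu1 < mu2, [x_i] and [y_i] are nonnegative for all
   [i] by induction; eliminating [x_i] then gives a recursion for [z_i] alone,
   with forcing slope of the sign of [drift] below. *)
Require Import Defs.
From Stdlib Require Import Reals Lra Lia.
Open Scope R_scope.

(** * Gaps and the policies they induce *)

Definition gap (v : nat -> nat -> nat -> nat -> R) (i j k l : nat) : R :=
  after v i j k l Station1 - after v i j k l Station2.

Lemma optimal_Station1 v i j k l :
  gap v i j k l <= 0 -> optimal_decision v i j k l Station1.
Proof.
unfold gap, optimal_decision, min_after; intros H.
rewrite Rmin_left; lra.
Qed.

Lemma optimal_Station2 v i j k l :
  0 <= gap v i j k l -> optimal_decision v i j k l Station2.
Proof.
unfold gap, optimal_decision, min_after; intros H.
rewrite Rmin_right; lra.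
Qed.

(** [prefer1] and [prefer2] differ only at ties, so a weak sign of the gap already forces the wanted
    action. *)
Definition prefer1 v i j k l : action :=
  if Rle_dec (gap v i j k l) 0 then Station1 else Station2.

Definition prefer2 v i j k l : action :=
  if Rle_dec 0 (gap v i j k l) then Station2 else Station1.

Lemma prefer1_optimal v : optimal_policy v (prefer1 v).
Proof.
intros i j k l _; unfold prefer1; destruct Rle_dec.
- now apply optimal_Station1.
- apply optimal_Station2; lra.
Qed.

Lemma prefer2_optimal v : optimal_policy v (prefer2 v).
Proof.
intros i j k l _; unfold prefer2; destruct Rle_dec.
- now apply optimal_Station2.
- apply optimal_Station1; lra.
Qed.

Lemma prefer1_Station1 v i j k l :
  gap v i j k l <= 0 -> prefer1 v i j k l = Station1.
Proof. unfold prefer1; destruct Rle_dec; [reflexivity|contradiction]. Qed.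

Lemma prefer2_Station2 v i j k l :
  0 <= gap v i j k l -> prefer2 v i j k l = Station2.
Proof. unfold prefer2; destruct Rle_dec; [reflexivity|contradiction]. Qed.

(** * Eventual signs of contracting recursions *)

Lemma affine_eventually_nonpos (C c : R) :
  0 < c -> exists N : nat, forall i, (N <= i)%nat -> C - c * INR i <= 0.
Proof.
intros Hc; destruct (INR_unbounded (C / c)) as [N HN].
exists N; intros i Hi; apply le_INR in Hi.
assert (C = c * (C / c)) by (field; lra).
nra.
Qed.

(** The positive part of [z] stays below a constant [U]; the feedback is then at most [r * U], and
    the decreasing forcing eventually outweighs it. *)
Lemma contraction_eventually_nonpos (z : nat -> R) (a r C c : R) :
  0 < c -> 0 <= r < a ->
  (forall i, a * z (S i) <= C - c * INR i + r * Rmax (z i) 0) ->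
  exists N : nat, forall i, (N <= i)%nat -> z i <= 0.
Proof.
intros Hc Hr Hz.
(* [U] dominates the initial positive part and satisfies [Rmax C 0 + r * U <= a * U], so the bound
   propagates. *)
set (U := Rmax (z 0%nat) 0 + Rmax C 0 / (a - r)).
assert (HC : 0 <= Rmax C 0 / (a - r)).
{ apply Rmult_le_pos; [apply Rmax_r|].
  apply Rlt_le, Rinv_0_lt_compat; lra. }
assert (HU : Rmax C 0 + r * U <= a * U).
{ assert (Rmax C 0 = (a - r) * (Rmax C 0 / (a - r))) by (field; lra).
  pose proof (Rmax_r (z 0%nat) 0); unfold U; nra. }
assert (Hbound : forall i, Rmax (z i) 0 <= U).
{ induction i as [|i IH]; [unfold U; lra|].
  pose proof (Rmax_r (z i) 0); pose proof (Rmax_l C 0); pose proof (pos_INR i).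
  specialize (Hz i).
  apply Rmax_lub; nra. }
destruct (affine_eventually_nonpos (C + r * U) c Hc) as [N HN].
exists (S N); intros [|i] Hi; [lia|].
specialize (HN i ltac:(lia)); specialize (Hz i); specialize (Hbound i).
nra.
Qed.

(** * Recursions for the gaps *)

Lemma min_after_Rmin v i j k l :
  min_after v i j k l = after v i j k l Station2 + Rmin (gap v i j k l) 0.
Proof. unfold min_after, gap, Rmin; repeat destruct Rle_dec; lra. Qed.

(** Station 2 from (i,1,1,0) and Station 1 from (i,1,0,1) both lead to (i,0,1,1). Using
    [min_after_Rmin] at the former and this form at the latter makes both equations refer to that
    one value. *)
Lemma min_after_Rmax v i j k l :
  min_after v i j k l = after v i j k l Station1 - Rmax (gap v i j k l) 0.
Proof. unfold min_after, gap, Rmin, Rmax; repeat destruct Rle_dec; lra. Qed.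

Lemma value_mul mu0 mu1 mu2 h0 h1 h2 v i j k l :
  value_function mu0 mu1 mu2 h0 h1 h2 v -> nonempty_state i j k l ->
  total_rate mu0 mu1 mu2 j k l <> 0 ->
  total_rate mu0 mu1 mu2 j k l * v i j k l =
  match i with
  | O => INR j * h0 + INR k * h1 + INR l * h2
      + INR k * mu1 * v 0%nat j (k - 1)%nat l
      + INR (Nat.min l 1) * mu2 * v 0%nat j k (l - 1)%nat
      + INR j * mu0 * min_after v 0%nat j k l
  | S i' => INR (i + j) * h0 + INR k * h1 + INR l * h2
      + INR k * mu1 * v i' (j + 1)%nat (k - 1)%nat l
      + INR (Nat.min l 1) * mu2 * v i' (j + 1)%nat k (l - 1)%nat
      + INR j * mu0 * min_after v i j k l
  end.
Proof.
intros [_ Hv] Hs Hd; rewrite (Hv i j k l Hs); unfold bellman.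
destruct i; field; exact Hd.
Qed.

(* At i = 0 the predecessor of the gap at (i,2,0,0) is the gap at (0,1,0,0). *)
Definition previous_gap (v : nat -> nat -> nat -> nat -> R) (i : nat) : R :=
  match i with
  | O => gap v 0 1 0 0
  | S i' => gap v i' 2 0 0
  end.

Ltac value_at H Hv i j k l :=
  pose proof (value_mul _ _ _ _ _ _ _ i j k l Hv) as H;
  unfold nonempty_state, total_rate in H;
  specialize (H ltac:(lia));
  rewrite ?plus_INR, ?S_INR in H; simpl in H;
  specialize (H ltac:(lra)).

(** Neither (i,0,2,0) nor (i,0,1,1) has a job in service at Station 0, so no minimum occurs. For
    positive [i] the next departures lead to (i-1,1,1,0) and (i-1,1,0,1), whose difference is the
    previous gap. The same mechanism gives [gap101_recursion]. *)
Lemma gap110_recursion mu0 mu1 mu2 h0 h1 h2 v i :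
  0 < mu0 -> 0 < mu1 -> 0 < mu2 ->
  value_function mu0 mu1 mu2 h0 h1 h2 v ->
  2 * mu1 * (mu1 + mu2) * gap v i 1 1 0 =
  INR i * h0 * (mu2 - mu1) + 2 * (mu2 * h1 - mu1 * h2)
  + 2 * mu1 * mu1 * previous_gap v i.
Proof.
intros Hmu0 Hmu1 Hmu2 Hv.
value_at HD Hv i 0%nat 2%nat 0%nat.
value_at HE Hv i 0%nat 1%nat 1%nat.
destruct i; unfold previous_gap, gap, after; rewrite ?S_INR in *; simpl in *; nra.
Qed.

Lemma gap101_recursion mu0 mu1 mu2 h0 h1 h2 v i :
  0 < mu0 -> 0 < mu1 -> 0 < mu2 ->
  value_function mu0 mu1 mu2 h0 h1 h2 v ->
  mu2 * (mu1 + mu2) * gap v i 1 0 1 =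
  - INR i * h0 * mu1 + (mu2 * h1 - mu2 * h2 - 2 * mu1 * h2)
  + mu2 * mu2 * previous_gap v i.
Proof.
intros Hmu0 Hmu1 Hmu2 Hv.
value_at HE Hv i 0%nat 1%nat 1%nat.
value_at HF Hv i 0%nat 0%nat 2%nat.
destruct i; unfold previous_gap, gap, after; rewrite ?S_INR in *; simpl in *; nra.
Qed.

(* [A], [B], [C], [E] are the values at (i-1,2,0,0), (i,1,1,0), (i,1,0,1) and
   (i,0,1,1), and [b], [c] those at (i-1,1,1,0) and (i-1,1,0,1). *)
Lemma gap200_algebra mu0 mu1 mu2 h0 h1 h2 I H A B C E b c m mB mC :
  (mu0 + mu1) * B = (I + 1) * h0 + h1 + mu1 * A + mu0 * (E + mB) ->
  (mu0 + mu2) * C = (I + 1) * h0 + h2 + mu2 * A + mu0 * (E - mC) ->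
  (mu1 + mu2) * E = I * h0 + h1 + h2 + mu1 * c + mu2 * b ->
  mu0 * A = H + mu0 * (c + m) ->
  2 * (mu1 + mu2) * (mu0 + mu1) * (mu0 + mu2) * (B - C) =
  (mu2 - mu1)
    * (2 * (mu1 + mu2) * ((I + 1) * h0 - H) + 2 * mu0 * (I * h0 + h1 + h2)
       + 2 * mu0 * (mu2 * (b - c) - (mu1 + mu2) * m))
  + 2 * (mu1 + mu2) * ((mu0 + mu2) * h1 - (mu0 + mu1) * h2)
  + 2 * (mu1 + mu2) * mu0 * (mu0 + mu2) * mB
  + 2 * (mu1 + mu2) * mu0 * (mu0 + mu1) * mC.
Proof.
intros HB HC HE HA.
replace (2 * (mu1 + mu2) * (mu0 + mu1) * (mu0 + mu2) * (B - C)) with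
  (2 * (mu1 + mu2) * ((mu0 + mu2) * ((mu0 + mu1) * B)
                      - (mu0 + mu1) * ((mu0 + mu2) * C))) by ring.
rewrite HB, HC.
(* [A] and [E] survive only through a multiple of [A - E]; substituting for them leaves
   [mu2 * (c - b)], so values of [v] remain only as gaps. *)
transitivity (2 * (mu1 + mu2) * ((mu0 + mu2) * ((I + 1) * h0 + h1 + mu0 * mB)
                                 - (mu0 + mu1) * ((I + 1) * h0 + h2 - mu0 * mC))
  + 2 * (mu1 - mu2) * ((mu1 + mu2) * (mu0 * A) - mu0 * ((mu1 + mu2) * E)));
  [ring|].
rewrite HA, HE; ring.
Qed.

(** The [match] comes from [2 * ((I + 1) * h0 - H)] in [gap200_algebra]. The predecessor (i-1,2,0,0)
    has two servers at Station 0, so [H] is half its holding cost; for [i = 0] the predecessor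
    (0,1,0,0) has one server, [H] is [h0] and the term vanishes. *)
Lemma gap200_recursion mu0 mu1 mu2 h0 h1 h2 v i :
  0 < mu0 -> 0 < mu1 -> 0 < mu2 ->
  value_function mu0 mu1 mu2 h0 h1 h2 v ->
  2 * (mu1 + mu2) * (mu0 + mu1) * (mu0 + mu2) * gap v i 2 0 0 =
  (mu2 - mu1)
    * ((mu1 + mu2) * match i with O => 0 | S i' => INR i' + 2 end * h0
       + 2 * mu0 * (INR i * h0 + h1 + h2)
       + 2 * mu0 * (mu2 * previous_gap v i
                    - (mu1 + mu2) * Rmin (previous_gap v i) 0))
  + 2 * (mu1 + mu2) * ((mu0 + mu2) * h1 - (mu0 + mu1) * h2)
  + 2 * (mu1 + mu2) * mu0 * (mu0 + mu2) * Rmin (gap v i 1 1 0) 0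
  + 2 * (mu1 + mu2) * mu0 * (mu0 + mu1) * Rmax (gap v i 1 0 1) 0.
Proof.
intros Hmu0 Hmu1 Hmu2 Hv.
destruct i as [|i].
- value_at HB Hv 0%nat 1%nat 1%nat 0%nat.
  value_at HC Hv 0%nat 1%nat 0%nat 1%nat.
  value_at HE Hv 0%nat 0%nat 1%nat 1%nat.
  value_at HA Hv 0%nat 1%nat 0%nat 0%nat.
  rewrite min_after_Rmin in HA, HB; rewrite min_after_Rmax in HC.
  unfold previous_gap; set (m := Rmin (gap v 0 1 0 0) 0) in *.
  set (mB := Rmin (gap v 0%nat 1 1 0) 0) in *.
  set (mC := Rmax (gap v 0%nat 1 0 1) 0) in *.
  clearbody m mB mC.
  unfold gap, after in *; simpl in *.
  rewrite (gap200_algebra mu0 mu1 mu2 h0 h1 h2 0 h0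
    (v 0%nat 1%nat 0%nat 0%nat) _ _ (v 0%nat 0%nat 1%nat 1%nat)
    (v 0%nat 0%nat 1%nat 0%nat) (v 0%nat 0%nat 0%nat 1%nat) m mB mC);
    [ring|lra..].
- value_at HB Hv (S i) 1%nat 1%nat 0%nat.
  value_at HC Hv (S i) 1%nat 0%nat 1%nat.
  value_at HE Hv (S i) 0%nat 1%nat 1%nat.
  value_at HA Hv i 2%nat 0%nat 0%nat.
  assert (HA' : 2 * mu0 * v i 2%nat 0%nat 0%nat =
    (INR i + 2) * h0 + 2 * mu0 * min_after v i 2 0 0).
  { destruct i; rewrite ?S_INR in *; simpl in *; lra. }
  rewrite min_after_Rmin in HA', HB; rewrite min_after_Rmax in HC.
  unfold previous_gap; set (m := Rmin (gap v i 2 0 0) 0) in *.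
  set (mB := Rmin (gap v (S i) 1 1 0) 0) in *.
  set (mC := Rmax (gap v (S i) 1 0 1) 0) in *.
  clearbody m mB mC.
  unfold gap, after in *; rewrite S_INR in *; cbn [Nat.add Nat.sub] in *.
  rewrite (gap200_algebra mu0 mu1 mu2 h0 h1 h2 (INR i + 1) ((INR i + 2) * h0 / 2)
    (v i 2%nat 0%nat 0%nat) _ _ (v (S i) 0%nat 1%nat 1%nat)
    (v i 1%nat 1%nat 0%nat) (v i 1%nat 0%nat 1%nat) m mB mC);
    [field|lra..].
Qed.

(** * Station 1 faster than Station 2 *)

(** The only positive feedback in [gap200_recursion] is the positive part of the gap at (i,1,0,1),
    which [gap101_recursion] bounds by the positive part of the previous gap. The resulting
    recursion contracts, with forcing of negative slope. *)
Lemma gap200_eventually_nonpos mu0 mu1 mu2 h0 h1 h2 v :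
  0 < mu0 -> 0 < mu2 < mu1 -> 0 < h0 -> 0 < h1 -> 0 < h2 ->
  value_function mu0 mu1 mu2 h0 h1 h2 v ->
  exists N : nat, forall i, (N <= i)%nat -> gap v i 2 0 0 <= 0.
Proof.
intros Hmu0 [Hmu2 Hlt] Hh0 Hh1 Hh2 Hv.
assert (Hmu1 : 0 < mu1) by lra.
set (K := mu2 * h1 - mu2 * h2 - 2 * mu1 * h2).
(* [L] is nonnegative with [K <= mu2 * L], which yields the bound [Hzmax] below. *)
set (L := Rmax K 0 / mu2).
apply (contraction_eventually_nonpos (fun i => gap v i 2 0 0)
  (2 * (mu1 + mu2) * (mu0 + mu1) * (mu0 + mu2))
  (2 * mu0 * (mu0 + mu1) * mu2)
  (2 * (mu1 + mu2) * ((mu0 + mu2) * h1 - (mu0 + mu1) * h2)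
   + 2 * mu0 * (mu0 + mu1) * L)
  ((mu1 - mu2) * ((mu1 + mu2) * h0))).
- repeat apply Rmult_lt_0_compat; lra.
- split; [repeat apply Rmult_le_pos; lra|].
  replace (2 * (mu1 + mu2) * (mu0 + mu1) * (mu0 + mu2))
    with (2 * (mu0 + mu1) * ((mu1 + mu2) * (mu0 + mu2))) by ring.
  replace (2 * mu0 * (mu0 + mu1) * mu2)
    with (2 * (mu0 + mu1) * (mu0 * mu2)) by ring.
  apply Rmult_lt_compat_l; nra.
- intros i.
  rewrite (gap200_recursion mu0 mu1 mu2 h0 h1 h2 v (S i)) by assumption.
  pose proof (gap101_recursion mu0 mu1 mu2 h0 h1 h2 v (S i) Hmu0 Hmu1 Hmu2 Hv) as Hz.
  cbn [previous_gap] in *; rewrite S_INR in *; fold K in Hz.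
  pose proof (pos_INR i) as Hi.
  set (x := gap v i 2 0 0) in *; set (y := gap v (S i) 1 1 0) in *;
  set (z := gap v (S i) 1 0 1) in *.
  assert (Hx : 0 <= mu2 * x - (mu1 + mu2) * Rmin x 0)
    by (unfold Rmin; destruct Rle_dec; nra).
  assert (Hy : Rmin y 0 <= 0) by apply Rmin_r.
  assert (HL : 0 <= L).
  { apply Rmult_le_pos; [apply Rmax_r|apply Rlt_le, Rinv_0_lt_compat; lra]. }
  assert (HK : K <= mu2 * L).
  { unfold L; replace (mu2 * (Rmax K 0 / mu2)) with (Rmax K 0) by (field; lra).
    apply Rmax_l. }
  assert (Hzmax : (mu1 + mu2) * Rmax z 0 <= L + mu2 * Rmax x 0).
  { pose proof (Rmax_l x 0); pose proof (Rmax_r x 0).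
    assert (0 <= (INR i + 1) * h0 * mu1) by (repeat apply Rmult_le_pos; lra).
    assert ((mu1 + mu2) * z <= L + mu2 * Rmax x 0).
    { apply Rmult_le_reg_l with mu2; [lra|].
      assert (mu2 * mu2 * x <= mu2 * mu2 * Rmax x 0)
        by (apply Rmult_le_compat_l; nra).
      lra. }
    unfold Rmax at 1; destruct Rle_dec; nra. }
  assert (H1 : (mu1 - mu2) * ((mu1 + mu2) * h0) * INR i <= (mu1 - mu2) *
    ((mu1 + mu2) * (INR i + 2) * h0 + 2 * mu0 * ((INR i + 1) * h0 + h1 + h2)
     + 2 * mu0 * (mu2 * x - (mu1 + mu2) * Rmin x 0))).
  { rewrite Rmult_assoc; apply Rmult_le_compat_l; [lra|].
    assert (0 <= 2 * mu0 * ((INR i + 1) * h0 + h1 + h2)).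
    { apply Rmult_le_pos; [lra|]. nra. }
    assert (0 <= 2 * mu0 * (mu2 * x - (mu1 + mu2) * Rmin x 0)) by nra.
    assert (0 < (mu1 + mu2) * h0) by nra.
    nra. }
  assert (H2 : 2 * (mu1 + mu2) * mu0 * (mu0 + mu2) * Rmin y 0 <= 0).
  { assert (0 <= 2 * (mu1 + mu2) * mu0 * (mu0 + mu2))
      by (repeat apply Rmult_le_pos; lra).
    nra. }
  assert (H3 : 2 * mu0 * (mu0 + mu1) * ((mu1 + mu2) * Rmax z 0)
    <= 2 * mu0 * (mu0 + mu1) * (L + mu2 * Rmax x 0))
    by (apply Rmult_le_compat_l; [nra|exact Hzmax]).
  lra.
Qed.

Lemma gaps_eventually_nonpos mu0 mu1 mu2 h0 h1 h2 v :
  0 < mu0 -> 0 < mu2 < mu1 -> 0 < h0 -> 0 < h1 -> 0 < h2 ->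
  value_function mu0 mu1 mu2 h0 h1 h2 v ->
  exists N : nat, forall i j k l, decision_state_hat i j k l -> (N <= i)%nat ->
    gap v i j k l <= 0.
Proof.
intros Hmu0 Hmu Hh0 Hh1 Hh2 Hv.
destruct (gap200_eventually_nonpos mu0 mu1 mu2 h0 h1 h2 v) as [N0 HN0];
  try assumption.
assert (Hmu1 : 0 < mu1) by lra; destruct Hmu as [Hmu2 Hlt].
destruct (affine_eventually_nonpos (2 * (mu2 * h1 - mu1 * h2)) (h0 * (mu1 - mu2)))
  as [N1 HN1]; [nra|].
destruct (affine_eventually_nonpos (mu2 * h1 - mu2 * h2 - 2 * mu1 * h2) (h0 * mu1))
  as [N2 HN2]; [nra|].
(* The successor is needed because the gaps at [S i] are controlled by the gap at (i,2,0,0). *)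
exists (S (N0 + N1 + N2)); intros [|i] j k l Hs Hi; [lia|].
pose proof (HN0 i ltac:(lia)) as Hx.
pose proof (gap110_recursion mu0 mu1 mu2 h0 h1 h2 v (S i) Hmu0 Hmu1 Hmu2 Hv) as Hy.
pose proof (gap101_recursion mu0 mu1 mu2 h0 h1 h2 v (S i) Hmu0 Hmu1 Hmu2 Hv) as Hz.
cbn [previous_gap] in Hy, Hz.
specialize (HN1 (S i) ltac:(lia)); specialize (HN2 (S i) ltac:(lia)).
destruct Hs as [(-> & -> & ->)|[(-> & -> & ->)|(-> & -> & ->)]].
- apply HN0; lia.
- apply Rmult_le_reg_l with (mu2 * (mu1 + mu2)); [nra|]; nra.
- apply Rmult_le_reg_l with (2 * mu1 * (mu1 + mu2)); [nra|]; nra.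
Qed.

(** * Station 2 faster than Station 1 *)

(** Induction on the previous gap: once it is nonnegative, so is the gap at (i,1,1,0), both [Rmin]
    terms of [gap200_recursion] vanish, and what remains is nonnegative. *)
Lemma gaps_nonneg mu0 mu1 mu2 h0 h1 h2 v i :
  0 < mu0 -> 0 < mu1 < mu2 -> 0 < h0 -> 0 < h1 -> 0 < h2 ->
  mu1 * h2 <= mu2 * h1 ->
  value_function mu0 mu1 mu2 h0 h1 h2 v ->
  0 <= gap v i 2 0 0 /\ 0 <= gap v i 1 1 0 /\ 0 <= previous_gap v i.
Proof.
intros Hmu0 [Hmu1 Hlt] Hh0 Hh1 Hh2 Hh Hv.
assert (Hmu2 : 0 < mu2) by lra.
assert (Hstep : forall n, 0 <= previous_gap v n ->
  0 <= gap v n 2 0 0 /\ 0 <= gap v n 1 1 0 /\ 0 <= previous_gap v n).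
{ intros n Hx.
  pose proof (gap110_recursion mu0 mu1 mu2 h0 h1 h2 v n Hmu0 Hmu1 Hmu2 Hv) as Hy.
  pose proof (gap200_recursion mu0 mu1 mu2 h0 h1 h2 v n Hmu0 Hmu1 Hmu2 Hv) as HX.
  pose proof (pos_INR n) as Hn.
  set (x := previous_gap v n) in *.
  assert (Hy0 : 0 <= gap v n 1 1 0).
  { apply Rmult_le_reg_l with (2 * mu1 * (mu1 + mu2)); [nra|].
    assert (0 <= INR n * h0 * (mu2 - mu1)) by (repeat apply Rmult_le_pos; lra).
    assert (0 <= 2 * mu1 * mu1 * x) by (repeat apply Rmult_le_pos; lra).
    lra. }
  split; [|now split].
  rewrite (Rmin_right x 0), (Rmin_right (gap v n 1 1 0) 0) in HX by assumption.
  apply Rmult_le_reg_l with (2 * (mu1 + mu2) * (mu0 + mu1) * (mu0 + mu2)).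
  { repeat apply Rmult_lt_0_compat; lra. }
  rewrite HX, Rmult_0_r.
  set (e := match n with O => 0 | S i' => INR i' + 2 end) in *.
  assert (He : 0 <= e).
  { unfold e; destruct n as [|m]; [lra|pose proof (pos_INR m); lra]. }
  assert (Hz : 0 <= 2 * (mu1 + mu2) * mu0 * (mu0 + mu1) * Rmax (gap v n 1 0 1) 0).
  { repeat apply Rmult_le_pos; try lra; apply Rmax_r. }
  assert (H1 : 0 <= (mu2 - mu1) * ((mu1 + mu2) * e * h0
    + 2 * mu0 * (INR n * h0) + 2 * mu0 * (mu2 * x))).
  { apply Rmult_le_pos; [lra|].
    repeat apply Rplus_le_le_0_compat; repeat apply Rmult_le_pos; lra. }
  (* The terms independent of [n], [x] and the gaps add up to this product. *)
  assert (H2 : 0 <= 2 * (mu1 + mu2 + 2 * mu0) * (mu2 * h1 - mu1 * h2))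
    by (repeat apply Rmult_le_pos; lra).
  lra. }
apply Hstep; induction i as [|i IH]; [|exact (proj1 (Hstep i IH))].
(* The initial gap is [h1 / mu1 - h2 / mu2], whose sign is the cost hypothesis. *)
value_at Hb Hv 0%nat 0%nat 1%nat 0%nat.
value_at Hc Hv 0%nat 0%nat 0%nat 1%nat.
destruct Hv as [Hv0 _]; rewrite Hv0 in *.
unfold previous_gap, gap, after; simpl.
apply Rmult_le_reg_l with (mu1 * mu2); nra.
Qed.

(** * The gap at (i,1,0,1) and its drift *)

(** The summands are the slopes contributed by the forcing of [gap200_recursion], by the elimination
    of the previous gap, and by the forcing of [gap101_recursion]. *)
Definition drift mu0 mu1 mu2 : R :=
  mu2 * mu2 * (mu2 - mu1) * (mu1 + mu2 + 2 * mu0)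
  + 2 * mu0 * mu1 * mu2 * (mu2 - mu1)
  - 2 * mu1 * (mu1 + mu2) * (mu0 + mu1) * (mu0 + mu2).

(** [gap101_recursion] is used twice, around one step of [gap200_recursion] with vanishing [Rmin]
    terms. Indices start at [S i] because the [match] in [gap200_recursion] breaks affinity at 0. *)
Lemma gap101_autonomous mu0 mu1 mu2 h0 h1 h2 v :
  0 < mu0 -> 0 < mu1 < mu2 -> 0 < h0 -> 0 < h1 -> 0 < h2 ->
  mu1 * h2 <= mu2 * h1 ->
  value_function mu0 mu1 mu2 h0 h1 h2 v ->
  exists C, forall i,
    2 * mu2 * (mu1 + mu2) * (mu1 + mu2) * (mu0 + mu1) * (mu0 + mu2)
      * gap v (S (S i)) 1 0 1 =
    C + h0 * drift mu0 mu1 mu2 * INR i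
    + 2 * mu0 * mu2 * mu2 * (mu1 + mu2) * (mu2 - mu1) * gap v (S i) 1 0 1
    + 2 * mu0 * mu2 * mu2 * (mu1 + mu2) * (mu0 + mu1)
      * Rmax (gap v (S i) 1 0 1) 0.
Proof.
intros Hmu0 Hmu Hh0 Hh1 Hh2 Hh Hv.
assert (Hmu1 : 0 < mu1) by lra; assert (Hmu2 : 0 < mu2) by lra.
set (K := mu2 * h1 - mu2 * h2 - 2 * mu1 * h2).
exists (2 * (mu1 + mu2) * (mu0 + mu1) * (mu0 + mu2) * (K - 2 * h0 * mu1)
  + mu2 * mu2 * ((mu2 - mu1) * ((mu1 + mu2) * 2 * h0 + 2 * mu0 * (h0 + h1 + h2))
                 + 2 * (mu1 + mu2) * ((mu0 + mu2) * h1 - (mu0 + mu1) * h2))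
  + 2 * mu0 * mu2 * (mu2 - mu1) * (h0 * mu1 - K)).
intros i.
destruct (gaps_nonneg mu0 mu1 mu2 h0 h1 h2 v (S i)) as (_ & Hy & Hx);
  try assumption.
pose proof (gap101_recursion mu0 mu1 mu2 h0 h1 h2 v (S (S i)) Hmu0 Hmu1 Hmu2 Hv) as Hz.
pose proof (gap101_recursion mu0 mu1 mu2 h0 h1 h2 v (S i) Hmu0 Hmu1 Hmu2 Hv) as Hz'.
pose proof (gap200_recursion mu0 mu1 mu2 h0 h1 h2 v (S i) Hmu0 Hmu1 Hmu2 Hv) as HX.
rewrite (Rmin_right _ 0 Hx), (Rmin_right _ 0 Hy) in HX.
cbn [previous_gap] in *; rewrite !S_INR in *; fold K in Hz, Hz'.
set (m := Rmax _ _) in *; clearbody m.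
set (z := gap v (S i) 1 0 1) in *; set (z' := gap v (S (S i)) 1 0 1) in *.
set (x := gap v i 2 0 0) in *; set (x' := gap v (S i) 2 0 0) in *.
set (n := INR i) in *; clearbody z z' x x' n.
transitivity (2 * (mu1 + mu2) * (mu0 + mu1) * (mu0 + mu2)
  * (mu2 * (mu1 + mu2) * z')); [ring|].
rewrite Hz.
replace (2 * (mu1 + mu2) * (mu0 + mu1) * (mu0 + mu2)
  * (- (n + 1 + 1) * h0 * mu1 + K + mu2 * mu2 * x')) with
  (2 * (mu1 + mu2) * (mu0 + mu1) * (mu0 + mu2) * (K - (n + 2) * h0 * mu1)
   + mu2 * mu2 * (2 * (mu1 + mu2) * (mu0 + mu1) * (mu0 + mu2) * x')) by ring.
rewrite HX.
replace (2 * mu0 * mu2 * mu2 * (mu1 + mu2) * (mu2 - mu1) * z) with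
  (2 * mu0 * mu2 * (mu2 - mu1) * (mu2 * (mu1 + mu2) * z)) by ring.
rewrite Hz'; unfold drift; ring.
Qed.

(** The second factor is a quadratic in [mu0] whose constant term has the sign of [mu2 - 2 * mu1];
    this is the origin of the threshold [m1 = 2 * m2]. *)
Lemma drift_factor mu0 mu1 mu2 :
  drift mu0 mu1 mu2 =
  (mu1 + mu2) * ((mu1 + mu2) * mu2 * (mu2 - 2 * mu1)
    + 2 * mu0 * (mu2 * (mu2 - 2 * mu1) - mu1 * mu1) - 2 * mu1 * (mu0 * mu0)).
Proof. unfold drift; ring. Qed.

Lemma drift_neg mu0 mu1 mu2 :
  0 < mu0 -> 0 < mu1 -> 0 < mu2 -> mu2 <= 2 * mu1 -> drift mu0 mu1 mu2 < 0.
Proof.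
intros Hmu0 Hmu1 Hmu2 H; rewrite drift_factor.
assert (0 <= mu2 * (2 * mu1 - mu2)) by (apply Rmult_le_pos; lra).
assert (0 <= mu0 * (mu2 * (2 * mu1 - mu2))) by (apply Rmult_le_pos; lra).
assert (0 <= (mu1 + mu2) * (mu2 * (2 * mu1 - mu2))) by (apply Rmult_le_pos; lra).
assert (0 < mu0 * (mu1 * mu1)) by (repeat apply Rmult_lt_0_compat; lra).
assert (0 < mu1 * (mu0 * mu0)) by (repeat apply Rmult_lt_0_compat; lra).
rewrite <- (Rmult_0_r (mu1 + mu2)); apply Rmult_lt_compat_l; [lra|].
lra.
Qed.

Lemma drift_pos mu0 mu1 mu2 :
  0 < mu0 -> 0 < mu1 -> mu0 <= mu1 -> mu0 <= mu2 - 2 * mu1 ->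
  0 < drift mu0 mu1 mu2.
Proof.
intros Hmu0 Hmu1 H1 H2; rewrite drift_factor.
apply Rmult_lt_0_compat; [lra|].
assert (0 <= mu0 * (mu2 * (mu2 - 2 * mu1))) by (repeat apply Rmult_le_pos; lra).
(* Uses [mu1 + mu2 >= 3 * mu1] and [mu2 >= 2 * mu1]. The negative terms amount to at most
   [4 * (mu1 * mu1) * mu0]. *)
assert (6 * (mu1 * mu1) * mu0 <= (mu1 + mu2) * mu2 * (mu2 - 2 * mu1))
  by (apply Rmult_le_compat; nra).
assert (mu1 * (mu0 * mu0) <= mu1 * (mu0 * mu1))
  by (repeat apply Rmult_le_compat_l; lra).
assert (0 < mu1 * mu1 * mu0) by (repeat apply Rmult_lt_0_compat; lra).
lra.
Qed.

Lemma gap101_eventually_nonpos mu0 mu1 mu2 h0 h1 h2 v :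
  0 < mu0 -> 0 < mu1 < mu2 -> 0 < h0 -> 0 < h1 -> 0 < h2 ->
  mu1 * h2 <= mu2 * h1 -> drift mu0 mu1 mu2 < 0 ->
  value_function mu0 mu1 mu2 h0 h1 h2 v ->
  exists N : nat, forall i, (N <= i)%nat -> gap v i 1 0 1 <= 0.
Proof.
intros Hmu0 Hmu Hh0 Hh1 Hh2 Hh Hd Hv.
destruct (gap101_autonomous mu0 mu1 mu2 h0 h1 h2 v) as [C HC]; try assumption.
set (r1 := 2 * mu0 * mu2 * mu2 * (mu1 + mu2) * (mu2 - mu1)) in *.
set (r2 := 2 * mu0 * mu2 * mu2 * (mu1 + mu2) * (mu0 + mu1)) in *.
set (a := 2 * mu2 * (mu1 + mu2) * (mu1 + mu2) * (mu0 + mu1) * (mu0 + mu2)) in *.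
assert (Hr1 : 0 <= r1) by (repeat apply Rmult_le_pos; lra).
assert (Hr2 : 0 <= r2) by (repeat apply Rmult_le_pos; lra).
assert (Hr : r1 + r2 < a).
{ replace (r1 + r2) with (2 * mu2 * (mu1 + mu2) * (mu0 + mu2) * (mu0 * mu2))
    by (unfold r1, r2; ring).
  replace a with (2 * mu2 * (mu1 + mu2) * (mu0 + mu2)
    * ((mu1 + mu2) * (mu0 + mu1))) by (unfold a; ring).
  apply Rmult_lt_compat_l; [repeat apply Rmult_lt_0_compat; lra|nra]. }
(* The linear term is bounded by the positive part, so the feedback coefficients add up. *)
destruct (contraction_eventually_nonpos (fun i => gap v (S i) 1 0 1)
  a (r1 + r2) C (- (h0 * drift mu0 mu1 mu2))) as [N HN]; [nra|lra| |].
- intros i; rewrite HC; pose proof (Rmax_l (gap v (S i) 1 0 1) 0); nra.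
- exists (S N); intros [|i] Hi; [lia|apply HN; lia].
Qed.

Lemma gap101_eventually_nonneg mu0 mu1 mu2 h0 h1 h2 v :
  0 < mu0 -> 0 < mu1 < mu2 -> 0 < h0 -> 0 < h1 -> 0 < h2 ->
  mu1 * h2 <= mu2 * h1 -> 0 < drift mu0 mu1 mu2 ->
  value_function mu0 mu1 mu2 h0 h1 h2 v ->
  exists N : nat, forall i, (N <= i)%nat -> 0 <= gap v i 1 0 1.
Proof.
intros Hmu0 Hmu Hh0 Hh1 Hh2 Hh Hd Hv.
destruct (gap101_autonomous mu0 mu1 mu2 h0 h1 h2 v) as [C HC]; try assumption.
set (r1 := 2 * mu0 * mu2 * mu2 * (mu1 + mu2) * (mu2 - mu1)) in *.
set (r2 := 2 * mu0 * mu2 * mu2 * (mu1 + mu2) * (mu0 + mu1)) in *.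
set (a := 2 * mu2 * (mu1 + mu2) * (mu1 + mu2) * (mu0 + mu1) * (mu0 + mu2)) in *.
assert (Hr1 : 0 <= r1) by (repeat apply Rmult_le_pos; lra).
assert (Hr2 : 0 <= r2) by (repeat apply Rmult_le_pos; lra).
assert (Hr : r1 < a).
{ replace r1 with (2 * mu2 * (mu1 + mu2) * (mu0 * (mu2 * (mu2 - mu1))))
    by (unfold r1; ring).
  replace a with (2 * mu2 * (mu1 + mu2)
    * ((mu0 + mu1) * ((mu1 + mu2) * (mu0 + mu2)))) by (unfold a; ring).
  apply Rmult_lt_compat_l; [repeat apply Rmult_lt_0_compat; lra|].
  apply Rmult_le_0_lt_compat; nra. }
(* After the sign change the [Rmax] term only helps and is dropped, leaving [r1] alone as
   feedback. *)
destruct (contraction_eventually_nonpos (fun i => - gap v (S i) 1 0 1)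
  a r1 (- C) (h0 * drift mu0 mu1 mu2)) as [N HN]; [nra|lra| |].
- intros i; rewrite Ropp_mult_distr_r_reverse, HC.
  pose proof (Rmax_l (- gap v (S i) 1 0 1) 0).
  pose proof (Rmax_r (gap v (S i) 1 0 1) 0).
  nra.
- exists (S N); intros [|i] Hi; [lia|].
  specialize (HN i ltac:(lia)); simpl in HN; lra.
Qed.

Theorem theorem2p1 (mu1 mu2 h0 h1 h2 : R)
  (mu1_gt0 : 0 < mu1) (mu2_gt0 : 0 < mu2)
  (h0_gt0 : 0 < h0) (h1_gt0 : 0 < h1) (h2_gt0 : 0 < h2) :
  let m1 := / mu1 in
  let m2 := / mu2 in
  m1 * h1 >= m2 * h2 ->
  (* 1 *)
  (m1 < m2 ->
    forall (mu0 : R) (v : nat -> nat -> nat -> nat -> R),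
      0 < mu0 -> value_function mu0 mu1 mu2 h0 h1 h2 v ->
      exists (i' : nat) (p : nat -> nat -> nat -> nat -> action),
        optimal_policy v p /\
        forall i j k l : nat, decision_state_hat i j k l -> (i' <= i)%nat ->
          p i j k l = Station1)
  /\
  (m1 > m2 ->
    (* 2 (a) *)
    (forall (mu0 : R) (v : nat -> nat -> nat -> nat -> R),
      0 < mu0 -> value_function mu0 mu1 mu2 h0 h1 h2 v ->
      exists p : nat -> nat -> nat -> nat -> action,
        optimal_policy v p /\
        forall i : nat,
          p i 1%nat 1%nat 0%nat = Station2 /\ p i 2%nat 0%nat 0%nat = Station2)
    /\
    (* 2 (b) (i) *)
    (m2 < m1 <= 2 * m2 ->
      forall (mu0 : R) (v : nat -> nat -> nat -> nat -> R),
        0 < mu0 -> value_function mu0 mu1 mu2 h0 h1 h2 v ->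
        exists i' : nat, forall i : nat, (i' <= i)%nat ->
          optimal_decision v i 1%nat 0%nat 1%nat Station1)
    /\
    (* 2 (b) (ii) *)
    (m1 > 2 * m2 ->
      exists mu0' : R, mu0' > 0 /\
        forall (mu0 : R) (v : nat -> nat -> nat -> nat -> R),
          0 < mu0 < mu0' -> value_function mu0 mu1 mu2 h0 h1 h2 v ->
          exists (i' : nat) (p : nat -> nat -> nat -> nat -> action),
            optimal_policy v p /\
            forall i : nat, (i' <= i)%nat ->
              p i 1%nat 0%nat 1%nat = Station2)).
Proof.
intros m1 m2 Hh.
assert (Hp : 0 < mu1 * mu2) by (apply Rmult_lt_0_compat; assumption).
(* Turns comparisons of [m1] with [c * m2] into comparisons of [mu2] with [c * mu1]; used for [c]
   equal to 1 and 2. *)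
assert (Hsub : forall c, mu2 - c * mu1 = mu1 * mu2 * (m1 - c * m2))
  by (intros c; unfold m1, m2; field; lra).
assert (Hcost : mu1 * h2 <= mu2 * h1).
{ assert (mu2 * h1 - mu1 * h2 = mu1 * mu2 * (m1 * h1 - m2 * h2))
    by (unfold m1, m2; field; lra).
  nra. }
clearbody m1 m2.
split; [|intros Hm; assert (Hmu : 0 < mu1 < mu2)
    by (specialize (Hsub 1); nra);
  split; [|split]].
- intros Hm mu0 v Hmu0 Hv.
  destruct (gaps_eventually_nonpos mu0 mu1 mu2 h0 h1 h2 v) as [N HN];
    try assumption; [specialize (Hsub 1); nra|].
  exists N, (prefer1 v); split; [apply prefer1_optimal|].
  intros i j k l Hs Hi; apply prefer1_Station1, HN; assumption.
- intros mu0 v Hmu0 Hv; exists (prefer2 v); split; [apply prefer2_optimal|].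
  intros i; destruct (gaps_nonneg mu0 mu1 mu2 h0 h1 h2 v i) as (Hx & Hy & _);
    try assumption.
  split; apply prefer2_Station2; assumption.
- intros Hm2 mu0 v Hmu0 Hv.
  destruct (gap101_eventually_nonpos mu0 mu1 mu2 h0 h1 h2 v) as [N HN];
    try assumption; [specialize (Hsub 2); apply drift_neg; nra|].
  exists N; intros i Hi; apply optimal_Station1, HN, Hi.
(* Below this threshold both bounds on [mu0] required by [drift_pos] hold. *)
- intros Hm2; exists (Rmin mu1 (mu2 - 2 * mu1)); split.
  { specialize (Hsub 2); apply Rmin_glb_lt; nra. }
  intros mu0 v [Hmu0 Hlt] Hv.
  pose proof (Rmin_l mu1 (mu2 - 2 * mu1)); pose proof (Rmin_r mu1 (mu2 - 2 * mu1)).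
  destruct (gap101_eventually_nonneg mu0 mu1 mu2 h0 h1 h2 v) as [N HN];
    try assumption; [apply drift_pos; lra|].
  exists N, (prefer2 v); split; [apply prefer2_optimal|].
  intros i Hi; apply prefer2_Station2, HN, Hi.
Qed.
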